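(* (a) For every real $X>\frac14$, $$\sum_{k=0}^\infty\frac{1}{(k+1)X^{2k}\binom{4k}{2k}}=\frac{4X(12X-1)\cot^{-1}\sqrt{4X-1}}{\sqrt{4X-1}}-24X^2\left(\cot^{-1}\sqrt{4X-1}\right)^2-\frac{4X(12X+1)\tanh^{-1}\frac{1}{\sqrt{4X+1}}}{\sqrt{4X+1}}+24X^2\left(\tanh^{-1}\frac{1}{\sqrt{4X+1}}\right)^2.$$ (b) If $x$ is real with $x>\frac{1+\sqrt2}{2}$ or $x<\frac{1-\sqrt2}{2}$, then $$\sum_{k=0}^\infty\frac{2^{2k}}{(k+1)[x(1-x)]^{k}\binom{4k}{2k}}=\frac{2(1-x)(6x-1)}{1-2x}\sqrt{x}\,\tanh^{-1}\frac{1}{\sqrt{x}}+\frac{2x(6x-5)}{1-2x}\sqrt{1-x}\,\tanh^{-1}\frac{1}{\sqrt{1-x}}+3x(1-x)\left(\tanh^{-1}\frac{1}{\sqrt{x}}\right)^2+3x(1-x)\left(\tanh^{-1}\frac{1}{\sqrt{1-x}}\right)^2.$$ Moreover, every $x_0\in(-16,0)$ can be written as $x_0=\frac{4}{x(1-x)}$ for some real $x$ with $x>\frac{1+\sqrt2}{2}$ or $x<\frac{1-\sqrt2}{2}$.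
   Context: Square roots of non-zero complex numbers are $\sqrt z=\sqrt{|z|}\,e^{\frac i2\arg z}$ with $-\pi<\arg z\le\pi$ (so the square root of a negative real number is purely imaginary with positive imaginary part). The functions $\cot^{-1}$ and $\tanh^{-1}$ are the principal inverse functions: $\cot^{-1}y\in(0,\pi/2)$ for $y>0$, and $\tanh^{-1}z=\frac12\log\frac{1+z}{1-z}$ with the principal logarithm (so $\tanh^{-1}(iy)=i\tan^{-1}y$ for real $y$). *)

(* Defs.v *)
From Stdlib Require Import Reals Lra.
From Coquelicot Require Import Coquelicot.
Open Scope R_scope.

(* The value at z = 0 is irrelevant; for z <> 0 see [Carg_spec]. *)
Definition Carg (z : C) : R :=
  if Rle_dec 0 (Im z) then acos (Re z / Cmod z) else - acos (Re z / Cmod z).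

Definition Clog (z : C) : C := (ln (Cmod z), Carg z).

Definition Csqrt (z : C) : C :=
  (sqrt (Cmod z) * (cos (Carg z / 2), sin (Carg z / 2)))%C.

Definition Catanh (z : C) : C := (/ 2 * Clog ((1 + z) / (1 - z)))%C.

(* On y <= 0 this is the branch with values in [PI/2, PI); only y > 0 is used. *)
Definition acot (y : R) : R := PI / 2 - atan y.

Lemma Carg_spec (z : C) :
  z <> 0%C ->
  - PI < Carg z <= PI /\ z = (Cmod z * (cos (Carg z), sin (Carg z)))%C.
Proof.
intros Hz.
assert (Hm : 0 < Cmod z) by now apply Cmod_gt_0.
destruct z as [a b].
assert (Hab : Cmod (a, b) * Cmod (a, b) = a * a + b * b).
{ unfold Cmod; simpl. rewrite sqrt_sqrt; [ring | nra]. }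
unfold Carg, Re, Im; cbn [fst snd].
set (m := Cmod (a, b)) in *.
assert (Hr : a = m * (a / m)) by (field; lra).
set (t := a / m) in *.
assert (E : b * b = m * m * (1 - t * t)).
{ replace (m * m * (1 - t * t)) with (m * m - (m * t) * (m * t)) by ring.
  rewrite <- Hr. lra. }
assert (Ht2 : 0 <= 1 - t * t).
{ apply Rmult_le_reg_l with (m * m); [nra |]. rewrite <- E. nra. }
assert (Ht : -1 <= t <= 1) by (split; nra).
destruct (acos_bound t) as [H0 H1].
assert (Hs : sqrt (1 - t²) = Rabs b / m).
{ apply sqrt_lem_1.
  - unfold Rsqr; nra.
  - apply Rmult_le_pos; [apply Rabs_pos | left; now apply Rinv_0_lt_compat].
  - assert (Rabs b * Rabs b = b * b) by (rewrite <- Rabs_mult; apply Rabs_pos_eq; nra).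
    replace (Rabs b / m * (Rabs b / m)) with (Rabs b * Rabs b / (m * m)) by (field; lra).
    rewrite H, E. unfold Rsqr. field. lra. }
destruct (Rle_dec 0 b) as [Hb | Hb].
- split; [pose proof PI_RGT_0; lra |].
  rewrite cos_acos, sin_acos, Hs, Rabs_pos_eq by lra.
  unfold Cmult, RtoC; simpl. f_equal; [nra | field; lra].
- split.
  + pose proof PI_RGT_0.
    split; [| lra].
    destruct (Req_dec (acos t) PI) as [HP | HP]; [exfalso | lra].
    assert (S : sin (acos t) = 0) by (rewrite HP; apply sin_PI).
    rewrite sin_acos, Hs in S by lra.
    assert (Rabs b = m * (Rabs b / m)) by (field; lra).
    rewrite S, Rabs_left in H2; lra.
  + rewrite cos_neg, sin_neg, cos_acos, sin_acos, Hs, Rabs_left by lra.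
    unfold Cmult, RtoC; simpl. f_equal; [nra | field; lra].
Qed.

Lemma Csqrt_pos (x : R) : 0 < x -> Csqrt (RtoC x) = RtoC (sqrt x).
Proof.
intros Hx.
unfold Csqrt, Carg. rewrite Cmod_R, Rabs_pos_eq by lra.
unfold Re, Im, RtoC; simpl.
destruct (Rle_dec 0 0) as [_ | H]; [| lra].
replace (x / x) with 1 by (field; lra).
rewrite acos_1. replace (0 / 2) with 0 by field.
rewrite cos_0, sin_0. unfold Cmult; simpl. f_equal; ring.
Qed.

Lemma acot_spec (y : R) :
  0 < y -> 0 < acot y < PI / 2 /\ cos (acot y) / sin (acot y) = y.
Proof.
intros Hy. unfold acot.
pose proof (atan_bound y). pose proof (atan_increasing 0 y Hy) as H1.
rewrite atan_0 in H1.
split; [lra |].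
rewrite cos_shift, sin_shift. exact (tan_atan y).
Qed.

(* Main.v *)
Require Import Defs.
From Stdlib Require Import Reals Lra Lia.
From Coquelicot Require Import Coquelicot.
Open Scope R_scope.

(** Both series are values of G(u) = sum_k u^k / ((k+1) C(4k,2k)), |u| < 16,
    at u = 1/X^2 and at u = 4/(x(1-x)).

    Writing u = t^2, the terms of G are those with even index in
    2 sum_m t^m / ((m+2) C(2m,m)), and sums with inverse central binomial
    coefficients C(2m,m) come from
      Y(t) = asin(sqrt t / 2)^2 = sum_(m>=1) t^m / (2 m^2 C(2m,m)).
    Splitting Y'(t) = evenS(t^2) + t oddS(t^2), and calling u primS(u) the
    even part of Y(t), a comparison of coefficients gives
      G = 96 oddS - 8 evenS - 48 primS   ([is_series_inv_central_binomial]).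
    Working with u rather than t keeps everything real even for u < 0, where
    t is imaginary, and lets one pair of power series serve both formulas.

    The hypergeometric recurrence of the coefficients becomes a first-order
    linear system for (evenS, oddS) ([euler_evenS_oddS]), which encodes the
    derivative of the identity 2 sin (2 w) Y'(4 (sin w)^2) = w.  The two formulas
    need it for real w, for imaginary w, and on a curve of complex w:
    - w real with sin w = y, and w = i z with sinh z = y, both giving
      u = 16 y^4; then w = atan (y / sqrt (1 - y^2)) and
      z = artanh (y / sqrt (1 + y^2));
    - 2 w = alpha + i beta with cos alpha cosh beta = 1 and
      sin alpha = tanh beta = y, for which t = 4 (sin w)^2 = 2 (1 - cos (2 w))
      is imaginary and u = - 4 y^4 / (1 - y^2); then
      alpha = atan (y / sqrt (1 - y^2)) and beta = artanh y.
    Each resulting identity between the power series and an inverse function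
    holds at y = 0, and the system shows that both sides have the same
    derivative in y, so it holds throughout the disc of convergence (the lemmas
    [*_closed_form*]).  Solving them for evenS, oddS and primS at
    y = 1 / (2 sqrt X), respectively y = 1 / sqrt x, gives the two formulas.
    For x < 0 the second one follows from x > 1 by the symmetry x <-> 1 - x. *)

(** * Coefficients *)

Lemma central_binomial_pos (n : nat) : 0 < Binomial.C (2 * n) n.
Proof.
unfold Binomial.C.
apply Rdiv_lt_0_compat; [| apply Rmult_lt_0_compat]; apply INR_fact_lt_0.
Qed.

Lemma central_binomial_succ (n : nat) :
  Binomial.C (2 * S n) (S n) =
  Binomial.C (2 * n) n * (2 * (2 * INR n + 1)) / (INR n + 1).
Proof.
unfold Binomial.C.
replace (2 * S n - S n)%nat with (S n) by lia.
replace (2 * n - n)%nat with n by lia.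
replace (2 * S n)%nat with (S (S (2 * n))) by lia.
rewrite !fact_simpl, !mult_INR, !S_INR, mult_INR.
change (INR 2) with 2.
pose proof (pos_INR n). pose proof (INR_fact_neq_0 n).
field. repeat split; lra || assumption.
Qed.

(** With v_m = 1 / (2 (m+1) C(2m+2,m+1)), the coefficients of the derivative of
    asin(sqrt t / 2)^2, these are v_(2k), v_(2k+1) and v_(2k+1) / (2k+2).  The
    last one integrates the odd terms of the derivative back. *)
Definition even_coef (k : nat) : R :=
  / (4 * (4 * INR k + 1) * Binomial.C (4 * k) (2 * k)).

Definition odd_coef (k : nat) : R :=
  even_coef k * (2 * INR k + 1) / (8 * INR k + 6).

Definition prim_coef (k : nat) : R := odd_coef k / (2 * INR k + 2).

(** One half of the recurrence (4m+2) v_m = m v_(m-1); the other half, for odd m,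
    is the definition of [odd_coef]. *)
Lemma even_coef_succ (k : nat) :
  (8 * INR k + 10) * even_coef (S k) = (2 * INR k + 2) * odd_coef k.
Proof.
unfold odd_coef, even_coef.
replace (4 * S k)%nat with (2 * S (S (2 * k)))%nat by lia.
replace (2 * S k)%nat with (S (S (2 * k))) by lia.
rewrite !central_binomial_succ.
replace (2 * (2 * k))%nat with (4 * k)%nat by lia.
rewrite !S_INR, mult_INR; change (INR 2) with 2.
pose proof (pos_INR k).
assert (HC : Binomial.C (4 * k) (2 * k) <> 0).
{ replace (4 * k)%nat with (2 * (2 * k))%nat by lia.
  apply Rgt_not_eq, central_binomial_pos. }
field. repeat split; lra || assumption.
Qed.

Lemma even_coef_bound (k : nat) : 0 < even_coef k /\ even_coef k * 16 ^ k <= 1.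
Proof.
induction k as [| k [IH0 IH]].
- unfold even_coef, Binomial.C; simpl. lra.
- assert (E : even_coef (S k) * 16 =
    (even_coef k) * (16 * (INR k + 1) * (2 * INR k + 1)
                  / ((4 * INR k + 5) * (8 * INR k + 6)))).
  { pose proof (even_coef_succ k) as H. unfold odd_coef in H.
    pose proof (pos_INR k).
    apply Rmult_eq_reg_l with (8 * INR k + 10); [| lra].
    rewrite <- Rmult_assoc, H. field. lra. }
  pose proof (pos_INR k) as Hk.
  set (q := _ / _) in E.
  assert (Hq : 0 < q <= 1).
  { unfold q; split.
    - apply Rdiv_lt_0_compat; nra.
    - apply Rle_div_l; nra. }
  split; [nra |].
  replace (even_coef (S k) * 16 ^ S k) with (even_coef k * 16 ^ k * q)
    by (simpl; rewrite <- Rmult_assoc, E; ring).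
  assert (0 < 16 ^ k) by (apply pow_lt; lra).
  assert (0 < even_coef k * 16 ^ k) by nra.
  nra.
Qed.

Lemma odd_coef_bound (k : nat) : 0 < odd_coef k <= even_coef k.
Proof.
destruct (even_coef_bound k) as [H _]. pose proof (pos_INR k) as Hk.
unfold odd_coef, Rdiv. rewrite Rmult_assoc.
assert (Hq : 0 < (2 * INR k + 1) / (8 * INR k + 6) <= 1).
{ split; [apply Rdiv_lt_0_compat | apply Rle_div_l]; lra. }
unfold Rdiv in Hq. nra.
Qed.

Lemma prim_coef_bound (k : nat) : 0 < prim_coef k <= even_coef k.
Proof.
pose proof (odd_coef_bound k) as H. pose proof (pos_INR k) as Hk.
unfold prim_coef. split; [apply Rdiv_lt_0_compat; lra |].
apply Rle_div_l; nra.
Qed.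

(** * The power series and their differential equations *)

Lemma CV_radius_ge_16 (a : nat -> R) (u : R) :
  (forall k, 0 < a k <= even_coef k) -> Rabs u < 16 ->
  Rbar_lt (Rabs u) (CV_radius a).
Proof.
intros Ha Hu.
apply Rbar_lt_le_trans with 16; [exact Hu |].
apply (proj1 (CV_radius_bounded a)).
exists 1. intros k.
destruct (even_coef_bound k) as [_ H]. specialize (Ha k).
assert (0 < 16 ^ k) by (apply pow_lt; lra).
rewrite Rabs_pos_eq; nra.
Qed.

Notation evenS := (PSeries even_coef).
Notation oddS := (PSeries odd_coef).
Notation primS := (PSeries prim_coef).

Lemma even_coef_radius (u : R) : Rabs u < 16 -> Rbar_lt (Rabs u) (CV_radius even_coef).
Proof.
apply CV_radius_ge_16. intros k. pose proof (even_coef_bound k). lra.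
Qed.

Lemma odd_coef_radius (u : R) : Rabs u < 16 -> Rbar_lt (Rabs u) (CV_radius odd_coef).
Proof. apply CV_radius_ge_16, odd_coef_bound. Qed.

Lemma prim_coef_radius (u : R) : Rabs u < 16 -> Rbar_lt (Rabs u) (CV_radius prim_coef).
Proof. apply CV_radius_ge_16, prim_coef_bound. Qed.

Lemma is_series_PSeries (a : nat -> R) (u : R) :
  Rbar_lt (Rabs u) (CV_radius a) ->
  is_series (fun k => a k * u ^ k) (PSeries a u).
Proof.
intros H. apply is_pseries_R, PSeries_correct, CV_radius_inside, H.
Qed.

Lemma is_series_euler_PSeries (a : nat -> R) (u : R) :
  Rbar_lt (Rabs u) (CV_radius a) ->
  is_series (fun k => INR k * a k * u ^ k) (u * Derive (PSeries a) u).
Proof.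
intros H.
apply is_series_ext with (fun k => PS_incr_1 (PS_derive a) k * u ^ k).
- intros [| k]; [| reflexivity].
  simpl. unfold zero; simpl. ring.
- apply is_pseries_R.
  apply (is_pseries_incr_1 (PS_derive a) u (Derive (PSeries a) u)).
  now apply is_pseries_derive.
Qed.

Lemma is_series_lin_comb (a b : nat -> R) (x y s t : R) :
  is_series a s -> is_series b t ->
  is_series (fun k => x * a k + y * b k) (x * s + y * t).
Proof.
intros Ha Hb.
apply (is_series_plus (fun k => x * a k) (fun k => y * b k)).
- exact (is_series_scal_l x a s Ha).
- exact (is_series_scal_l y b t Hb).
Qed.

Lemma is_series_eq (a b : nat -> R) (s t : R) :
  is_series a s -> is_series b t -> (forall k, a k = b k) -> s = t.
Proof.
intros Ha Hb E.
rewrite <- (is_series_unique _ _ Ha), <- (is_series_unique _ _ Hb).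
apply Series_ext, E.
Qed.

(** The recurrences of the coefficients are two linear relations between the Euler
    derivatives u f'(u) of the two series; solving them puts the system in normal
    form.  Their determinant is proportional to 16 - u, which vanishes at the radius
    of convergence. *)
Lemma euler_evenS_oddS (u : R) : Rabs u < 16 ->
  u * Derive evenS u = (u * oddS u + (u / 2 - 4) * evenS u + 1) / (16 - u) /\
  u * Derive oddS u = ((u - 12) * oddS u + evenS u + 1 / 4) / (16 - u).
Proof.
intros Hu.
pose proof (is_series_PSeries _ u (even_coef_radius u Hu)) as SA.
pose proof (is_series_PSeries _ u (odd_coef_radius u Hu)) as SB.
pose proof (is_series_euler_PSeries _ u (even_coef_radius u Hu)) as TA.
pose proof (is_series_euler_PSeries _ u (odd_coef_radius u Hu)) as TB.
set (A := evenS u) in *. set (B := oddS u) in *.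
set (DA := u * Derive evenS u) in *. set (DB := u * Derive oddS u) in *.
assert (E1 : 8 * DB + 6 * B = 2 * DA + 1 * A).
{ apply (is_series_eq _ _ _ _ (is_series_lin_comb _ _ 8 6 _ _ TB SB)
                              (is_series_lin_comb _ _ 2 1 _ _ TA SA)).
  intros k. unfold odd_coef. pose proof (pos_INR k). field. lra. }
(* Here the recurrence shifts the index, so the constant term 2 v_0 = 1/2 is
   left over as an inhomogeneity. *)
assert (E2 : 8 * DA + 2 * A = u * (2 * DB + 2 * B) + / 2).
{ refine (is_series_eq _ _ _ _ (is_series_lin_comb _ _ 8 2 _ _ TA SA) _
            (fun k => eq_refl)).
  apply is_series_decr_1.
  apply is_series_ext with
    (fun k => u * (2 * (INR k * odd_coef k * u ^ k) + 2 * (odd_coef k * u ^ k))).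
  - intros k. rewrite S_INR. simpl pow.
    transitivity ((2 * INR k + 2) * odd_coef k * (u * u ^ k)); [simpl; ring |].
    rewrite <- even_coef_succ. simpl; ring.
  - replace (plus _ _) with (u * (2 * DB + 2 * B)).
    + exact (is_series_scal_l u _ _ (is_series_lin_comb _ _ 2 2 _ _ TB SB)).
    + unfold plus, opp, even_coef, Binomial.C; simpl. field. }
apply Rabs_def2 in Hu.
split; apply Rmult_eq_reg_l with (16 - u); try lra; field_simplify; lra || nra.
Qed.

Lemma is_derive_mult_primS (u : R) : Rabs u < 16 ->
  is_derive (fun v => v * primS v) u (oddS u / 2).
Proof.
intros Hu.
apply is_derive_ext with (PSeries (PS_incr_1 prim_coef)).
{ intros v. apply PSeries_incr_1. }
replace (oddS u / 2) with (PSeries (PS_derive (PS_incr_1 prim_coef)) u).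
- apply is_derive_PSeries. rewrite CV_radius_incr_1. now apply prim_coef_radius.
- unfold Rdiv. rewrite Rmult_comm, <- PSeries_scal. apply PSeries_ext. intros k.
  unfold PS_derive, PS_incr_1, PS_scal, prim_coef, scal; cbn -[INR].
  unfold mult; cbn -[INR]. rewrite S_INR. pose proof (pos_INR k). field. lra.
Qed.

(** With y_m = 1 / (2 m^2 C(2m,m)), the coefficients of asin(sqrt t / 2)^2,
      1 / ((m+2) C(2m,m)) = 24 (2m+3) y_(m+2) - 4 (m+1) y_(m+1);
    this is twice the case m = 2k, rewritten by m y_m = v_(m-1). *)
Lemma coef_combination (k : nat) :
  96 * odd_coef k - 8 * even_coef k - 48 * prim_coef k =
  / (INR (k + 1) * Binomial.C (4 * k) (2 * k)).
Proof.
unfold prim_coef, odd_coef, even_coef.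
rewrite plus_INR; change (INR 1) with 1.
assert (HC : Binomial.C (4 * k) (2 * k) <> 0).
{ replace (4 * k)%nat with (2 * (2 * k))%nat by lia.
  apply Rgt_not_eq, central_binomial_pos. }
pose proof (pos_INR k). field. repeat split; lra || assumption.
Qed.

Lemma is_series_inv_central_binomial (u : R) : Rabs u < 16 ->
  is_series (fun k => u ^ k / (INR (k + 1) * Binomial.C (4 * k) (2 * k)))
    (96 * oddS u - 8 * evenS u - 48 * primS u).
Proof.
intros Hu.
replace (96 * oddS u - 8 * evenS u - 48 * primS u)
  with (1 * (96 * oddS u + (- 8) * evenS u) + (- 48) * primS u) by ring.
apply is_series_ext with
  (fun k => 1 * (96 * (odd_coef k * u ^ k) + (- 8) * (even_coef k * u ^ k))
            + (- 48) * (prim_coef k * u ^ k)).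
- intros k. unfold Rdiv. rewrite <- coef_combination. simpl; ring.
- apply (is_series_lin_comb
           (fun k => 96 * (odd_coef k * u ^ k) + (- 8) * (even_coef k * u ^ k))).
  + apply (is_series_lin_comb (fun k => odd_coef k * u ^ k)); apply is_series_PSeries.
    * now apply odd_coef_radius.
    * now apply even_coef_radius.
  + apply is_series_PSeries. now apply prim_coef_radius.
Qed.

(** * Inverse functions *)
Definition artanh (y : R) : R := / 2 * ln ((1 + y) / (1 - y)).

Lemma is_derive_artanh (y : R) : -1 < y < 1 -> is_derive artanh y (/ (1 - y ^ 2)).
Proof.
intros Hy. unfold artanh. auto_derive.
- split; [lra |]. split; [| exact I]. apply Rdiv_lt_0_compat; lra.
- field. repeat split; nra.
Qed.

Lemma artanh_0 : artanh 0 = 0.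
Proof.
unfold artanh. replace ((1 + 0) / (1 - 0)) with 1 by field. rewrite ln_1. ring.
Qed.

Lemma eq_of_derive (f g d : R -> R) (b : R) :
  0 <= b -> f 0 = g 0 ->
  (forall y, 0 <= y <= b -> is_derive f y (d y)) ->
  (forall y, 0 <= y <= b -> is_derive g y (d y)) ->
  f b = g b.
Proof.
intros [Hb | <-] H0 Hf Hg; [| exact H0].
enough (f 0 - g 0 = f b - g b) by lra.
apply (eq_is_derive (fun y => f y - g y)); [| exact Hb].
intros y Hy.
replace (@zero R_NormedModule) with (minus (d y) (d y))
  by (unfold minus, plus, opp, zero; simpl; ring).
apply @is_derive_minus; auto.
Qed.

Lemma ex_derive_evenS (u : R) : Rabs u < 16 -> ex_derive evenS u.
Proof. intros H. now apply ex_derive_PSeries, even_coef_radius. Qed.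

Lemma ex_derive_oddS (u : R) : Rabs u < 16 -> ex_derive oddS u.
Proof. intros H. now apply ex_derive_PSeries, odd_coef_radius. Qed.

Lemma sqrt_one_minus_sq (y : R) : 0 <= y < 1 ->
  0 < sqrt (1 - y ^ 2) /\ sqrt (1 - y ^ 2) ^ 2 = 1 - y ^ 2.
Proof.
intros Hy. split; [apply sqrt_lt_R0; nra | apply pow2_sqrt; nra].
Qed.

Lemma sqrt_one_plus_sq (y : R) :
  0 < sqrt (1 + y ^ 2) /\ sqrt (1 + y ^ 2) ^ 2 = 1 + y ^ 2.
Proof.
pose proof (pow2_ge_0 y).
split; [apply sqrt_lt_R0; lra | apply pow2_sqrt; lra].
Qed.

(** The function is asin, the form with atan being the one that meets acot. *)
Lemma is_derive_atan_arcsine (y : R) : 0 <= y < 1 ->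
  is_derive (fun y => atan (y / sqrt (1 - y ^ 2))) y (/ sqrt (1 - y ^ 2)).
Proof.
intros Hy. destruct (sqrt_one_minus_sq y Hy) as [Hc0 Hc].
auto_derive; replace (1 + - (y * (y * 1))) with (1 - y ^ 2) by ring.
- split; [nra |]. split; [lra | exact I].
- set (c := sqrt (1 - y ^ 2)) in *.
  assert (c * c + y * y <> 0) by nra.
  field_simplify_eq; [| split; [nra | lra]]. ring [Hc].
Qed.

(** The function is arsinh. *)
Lemma is_derive_artanh_arsinh (y : R) :
  is_derive (fun y => artanh (y / sqrt (1 + y ^ 2))) y (/ sqrt (1 + y ^ 2)).
Proof.
destruct (sqrt_one_plus_sq y) as [Hd0 Hd].
set (d := sqrt (1 + y ^ 2)) in *.
assert (Hr : -1 < y / d < 1).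
{ split; [apply Rlt_div_r | apply Rlt_div_l]; nra. }
evar_last.
- apply (is_derive_comp artanh (fun y => y / sqrt (1 + y ^ 2))).
  + now apply is_derive_artanh.
  + auto_derive; [| reflexivity].
    replace (1 + y * (y * 1)) with (1 + y ^ 2) by ring.
    fold d. pose proof (pow2_ge_0 y). repeat split; lra.
- unfold scal; simpl; unfold mult; simpl.
  replace (1 + y * (y * 1)) with (1 + y ^ 2) by ring. fold d.
  assert (1 - (y / d) ^ 2 <> 0) by nra.
  replace (1 - y / d * (y / d * 1)) with (/ d ^ 2).
  + field_simplify_eq; [| lra]. ring [Hd].
  + field_simplify_eq; [| lra]. rewrite Hd. ring.
Qed.

(** * Closed forms for positive argument *)

Lemma Rabs_16_pow4 (y : R) : 0 <= y < 1 -> Rabs (16 * y ^ 4) < 16.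
Proof.
intros Hy. assert (0 <= y ^ 2 < 1) by nra.
replace (16 * y ^ 4) with (16 * (y ^ 2 * y ^ 2)) by ring.
rewrite Rabs_pos_eq; nra.
Qed.

(** The sign e = 1 belongs to t = 4 y^2 and e = -1 to t = - 4 y^2; in both cases
    u = 16 y^4 and 16 - u = 16 (1 - y^2) (1 + y^2), so one factor cancels against
    the squared root and the differential system leaves a bare 1 / sqrt. *)
Lemma is_derive_real_combination (e y : R) : e * e = 1 -> 0 <= y < 1 ->
  is_derive (fun y => 4 * y * sqrt (1 - e * y ^ 2)
               * (evenS (16 * y ^ 4) + e * (4 * y ^ 2) * oddS (16 * y ^ 4)))
    y (/ sqrt (1 - e * y ^ 2)).
Proof.
intros He Hy.
pose proof (Rabs_16_pow4 y Hy) as Hu.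
destruct (euler_evenS_oddS _ Hu) as [EA EB].
assert (Hp : 0 < 1 - e * y ^ 2 /\ 0 < 1 + e * y ^ 2).
{ assert (-1 <= e <= 1) by nra. split; nra. }
destruct Hp as [Hp Hq].
assert (Hc0 := sqrt_lt_R0 _ Hp).
assert (Hc := pow2_sqrt _ (Rlt_le _ _ Hp)).
evar_last.
- auto_derive; [| reflexivity].
  replace (y * (y * (y * (y * 1)))) with (y ^ 4) by ring.
  replace (1 + - (e * (y * (y * 1)))) with (1 - e * y ^ 2) by ring.
  repeat split; [lra | now apply ex_derive_evenS | now apply ex_derive_oddS].
- replace (y * (y * (y * (y * 1)))) with (y ^ 4) by ring.
  replace (1 + - (e * (y * (y * 1)))) with (1 - e * y ^ 2) by ring.
  set (u := 16 * y ^ 4) in *. set (c := sqrt (1 - e * y ^ 2)) in *.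
  change (fun x => evenS x) with evenS. change (fun x => oddS x) with oddS.
  set (A := evenS u) in *. set (B := oddS u) in *.
  set (DA := Derive evenS u) in *. set (DB := Derive oddS u) in *.
  transitivity (4 * (c - e * y ^ 2 / c) * (A + e * (4 * y ^ 2) * B)
     + 4 * c * (4 * (u * DA) + 16 * e * y ^ 2 * (u * DB) + 8 * e * y ^ 2 * B)).
  { unfold u. field. lra. }
  rewrite EA, EB.
  replace (16 - u) with (16 * c ^ 2 * (1 + e * y ^ 2))
    by (rewrite Hc; unfold u; ring [He]).
  unfold u.
  assert (Hy2 : y ^ 2 = e * (1 - c ^ 2)) by (rewrite Hc; ring [He]).
  field_simplify_eq; [| split; [nra | lra]].
  ring [Hy2 He].
Qed.

Lemma atan_closed_form (y : R) : 0 <= y < 1 ->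
  atan (y / sqrt (1 - y ^ 2)) =
  4 * y * sqrt (1 - y ^ 2) * (evenS (16 * y ^ 4) + 4 * y ^ 2 * oddS (16 * y ^ 4)).
Proof.
intros Hy.
rewrite <- (Rmult_1_l (y ^ 2)) at 2. rewrite <- (Rmult_1_l (4 * y ^ 2)).
apply (eq_of_derive (fun y => atan (y / sqrt (1 - y ^ 2)))
  (fun y => 4 * y * sqrt (1 - 1 * y ^ 2)
            * (evenS (16 * y ^ 4) + 1 * (4 * y ^ 2) * oddS (16 * y ^ 4)))
  (fun y => / sqrt (1 - y ^ 2))); [lra | | |].
- unfold Rdiv. rewrite Rmult_0_l, atan_0. ring.
- intros z Hz. apply is_derive_atan_arcsine; lra.
- intros z Hz. rewrite <- (Rmult_1_l (z ^ 2)).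
  apply is_derive_real_combination; lra.
Qed.

Lemma artanh_closed_form (y : R) : 0 <= y < 1 ->
  artanh (y / sqrt (1 + y ^ 2)) =
  4 * y * sqrt (1 + y ^ 2) * (evenS (16 * y ^ 4) - 4 * y ^ 2 * oddS (16 * y ^ 4)).
Proof.
intros Hy.
assert (E : forall z, 1 + z ^ 2 = 1 - -1 * z ^ 2) by (intros; ring).
rewrite (E y) at 2.
replace (evenS (16 * y ^ 4) - 4 * y ^ 2 * oddS (16 * y ^ 4))
  with (evenS (16 * y ^ 4) + -1 * (4 * y ^ 2) * oddS (16 * y ^ 4)) by ring.
apply (eq_of_derive (fun y => artanh (y / sqrt (1 + y ^ 2)))
  (fun y => 4 * y * sqrt (1 - -1 * y ^ 2)
            * (evenS (16 * y ^ 4) + -1 * (4 * y ^ 2) * oddS (16 * y ^ 4)))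
  (fun y => / sqrt (1 + y ^ 2))); [lra | | |].
- unfold Rdiv. rewrite Rmult_0_l, artanh_0. ring.
- intros z _. apply is_derive_artanh_arsinh.
- intros z Hz. rewrite E. apply is_derive_real_combination; lra.
Qed.

Lemma is_derive_square (f : R -> R) (y d : R) :
  is_derive f y d -> is_derive (fun y => f y ^ 2) y (2 * f y * d).
Proof.
intros H. evar_last.
- apply (is_derive_pow f 2 y d H).
- simpl; ring.
Qed.

(** The even part of asin(sqrt t / 2)^2, which is - arsinh(sqrt (-t) / 2)^2 for
    t < 0. *)
Lemma primS_closed_form_pos (y : R) : 0 <= y < 1 ->
  16 * y ^ 4 * primS (16 * y ^ 4) =
  (atan (y / sqrt (1 - y ^ 2)) ^ 2 - artanh (y / sqrt (1 + y ^ 2)) ^ 2) / 2.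
Proof.
intros Hy.
apply (eq_of_derive (fun y => 16 * y ^ 4 * primS (16 * y ^ 4))
  (fun y => (atan (y / sqrt (1 - y ^ 2)) ^ 2
             - artanh (y / sqrt (1 + y ^ 2)) ^ 2) / 2)
  (fun y => 32 * y ^ 3 * oddS (16 * y ^ 4))); [lra | | |].
- unfold Rdiv. rewrite !Rmult_0_l, atan_0, artanh_0. ring.
- intros z Hz. evar_last.
  + apply (is_derive_comp (fun v => v * primS v) (fun y => 16 * y ^ 4)).
    * apply is_derive_mult_primS, Rabs_16_pow4; lra.
    * auto_derive; [exact I | reflexivity].
  + unfold scal; simpl; unfold mult; simpl. field.
- intros z Hz. assert (Hz1 : 0 <= z < 1) by lra.
  destruct (sqrt_one_minus_sq z Hz1) as [Hc0 _], (sqrt_one_plus_sq z) as [Hd0 _].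
  evar_last.
  + apply (is_derive_ext (fun y => / 2 * (atan (y / sqrt (1 - y ^ 2)) ^ 2
             - artanh (y / sqrt (1 + y ^ 2)) ^ 2))); [intros t; simpl; field; lra |].
    apply @is_derive_scal, @is_derive_minus; apply is_derive_square.
    * now apply is_derive_atan_arcsine.
    * apply is_derive_artanh_arsinh.
  + cbv beta. change minus with Rminus; cbv beta.
    rewrite atan_closed_form, artanh_closed_form by assumption.
    field. split; apply Rgt_not_eq; assumption.
Qed.

(** * Closed forms for negative argument *)

(** The value of u on the imaginary t-axis where 2 asin(sqrt t / 2) has real part
    asin y and imaginary part artanh y. *)
Definition curve (y : R) : R := - (4 * y ^ 4 / (1 - y ^ 2)).

(** The part of the curve on which |u| < 16. *)
Definition in_disc (y : R) : Prop := 0 <= y /\ y ^ 4 + 4 * y ^ 2 < 4.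

Lemma in_disc_lt_1 (y : R) : in_disc y -> 0 <= y < 1.
Proof.
intros [H0 H]. split; [exact H0 |].
destruct (Rlt_le_dec y 1) as [H1 | H1]; [exact H1 |].
assert (1 <= y ^ 2) by nra.
replace (y ^ 4) with (y ^ 2 * y ^ 2) in H by ring. nra.
Qed.

Lemma in_disc_le (y z : R) : in_disc y -> 0 <= z <= y -> in_disc z.
Proof.
intros [H0 H] Hz. split; [lra |].
assert (z ^ 2 <= y ^ 2) by (apply pow_incr; lra).
assert (z ^ 4 <= y ^ 4) by (apply pow_incr; lra).
lra.
Qed.

Lemma Rabs_curve (y : R) : in_disc y -> Rabs (curve y) < 16.
Proof.
intros Hy. pose proof (in_disc_lt_1 y Hy) as Hy1. destruct Hy as [_ Hy].
unfold curve. rewrite Rabs_Ropp, Rabs_pos_eq.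
- apply Rlt_div_l; nra.
- apply Rmult_le_pos; [| left; apply Rinv_0_lt_compat; nra].
  apply Rmult_le_pos; [lra | apply pow_le; lra].
Qed.

Lemma is_derive_curve (y : R) : 0 <= y < 1 ->
  is_derive curve y (- (8 * y ^ 3 * (2 - y ^ 2) / (1 - y ^ 2) ^ 2)).
Proof.
intros Hy. unfold curve. auto_derive; [nra |]. field. nra.
Qed.

(** Along the curve the singular factor y of the chain rule is kept on the left, so
    that the statement remains meaningful at the starting point y = 0. *)
Lemma euler_curve (f : R -> R) (y : R) : 0 <= y < 1 -> ex_derive f (curve y) ->
  exists d : R, is_derive (fun y => f (curve y)) y d /\
  y * d = 2 * (2 - y ^ 2) / (1 - y ^ 2) * (curve y * Derive f (curve y)).
Proof.
intros Hy Hf. eexists. split.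
- apply (is_derive_comp f curve).
  + now apply Derive_correct.
  + now apply is_derive_curve.
- unfold scal; simpl; unfold mult; simpl. unfold curve at 2. field. nra.
Qed.

Lemma one_minus_sq_pos y : 0 <= y < 1 -> 0 < 1 - y ^ 2.
Proof. nra. Qed.

(** On the curve 16 - u = 4 (2 - y^2)^2 / (1 - y^2); against the factor of
    [euler_curve] only 2 (2 - y^2) is left of it. *)
Lemma euler_evenS_oddS_curve (y : R) : in_disc y ->
  let u := curve y in
  exists dA dB : R,
  is_derive (fun y => evenS (curve y)) y dA /\
  is_derive (fun y => oddS (curve y)) y dB /\
  y * dA * (2 * (2 - y ^ 2)) = u * oddS u + (u / 2 - 4) * evenS u + 1 /\
  y * dB * (2 * (2 - y ^ 2)) = (u - 12) * oddS u + evenS u + 1 / 4.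
Proof.
intros Hy u.
pose proof (in_disc_lt_1 y Hy) as Hy1. pose proof (Rabs_curve y Hy) as Hu.
destruct (euler_evenS_oddS _ Hu) as [EA EB].
destruct (euler_curve evenS y Hy1 (ex_derive_evenS _ Hu)) as [dA [HA EA']].
destruct (euler_curve oddS y Hy1 (ex_derive_oddS _ Hu)) as [dB [HB EB']].
pose proof (one_minus_sq_pos y Hy1) as Hp.
exists dA, dB. split; [exact HA |]. split; [exact HB |]. split.
- rewrite EA', EA. fold u.
  replace (16 - u) with (4 * (2 - y ^ 2) ^ 2 / (1 - y ^ 2))
    by (unfold u, curve; field; lra).
  field. split; lra.
- rewrite EB', EB. fold u.
  replace (16 - u) with (4 * (2 - y ^ 2) ^ 2 / (1 - y ^ 2))
    by (unfold u, curve; field; lra).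
  field. split; lra.
Qed.

(** Real part of 4 sin (2 w) (evenS u + t oddS u) = 2 w, where
    sin (2 w) = y / c + i y and t = 2 i y^2 / c with c = sqrt (1 - y^2). *)
Lemma atan_closed_form_neg (y : R) : in_disc y ->
  atan (y / sqrt (1 - y ^ 2)) =
  4 * y / sqrt (1 - y ^ 2) * (evenS (curve y) - 2 * y ^ 2 * oddS (curve y)).
Proof.
intros Hy.
apply (eq_of_derive (fun y => atan (y / sqrt (1 - y ^ 2)))
  (fun y => 4 * y / sqrt (1 - y ^ 2) * (evenS (curve y) - 2 * y ^ 2 * oddS (curve y)))
  (fun y => / sqrt (1 - y ^ 2))).
- apply Hy.
- unfold Rdiv. rewrite Rmult_0_l, atan_0. ring.
- intros z Hz. apply is_derive_atan_arcsine.
  now apply in_disc_lt_1, in_disc_le with y.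
- intros z Hz. apply (in_disc_le _ _ Hy) in Hz. clear y Hy.
  pose proof (in_disc_lt_1 z Hz) as Hz1.
  destruct (sqrt_one_minus_sq z Hz1) as [Hc0 Hc].
  destruct (euler_evenS_oddS_curve z Hz) as (dA & dB & HA & HB & EA & EB).
  set (f := fun y => evenS (curve y)) in *. set (g := fun y => oddS (curve y)) in *.
  change (is_derive (fun y => 4 * y / sqrt (1 - y ^ 2) * (f y - 2 * y ^ 2 * g y))
            z (/ sqrt (1 - z ^ 2))).
  change (evenS (curve z)) with (f z) in *. change (oddS (curve z)) with (g z) in *.
  change (is_derive f z dA) in HA. change (is_derive g z dB) in HB.
  (* With opaque f and g, dA and dB enter without the chain rule through [curve],
     whose factors of y^3 hide the Euler derivatives. *)
  clearbody f g.
  evar_last.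
  + auto_derive; [| reflexivity].
    replace (1 + - (z * (z * 1))) with (1 - z ^ 2) by ring.
    repeat split; [apply one_minus_sq_pos, Hz1 | lra | eexists; exact HA | eexists; exact HB].
  + replace (1 + - (z * (z * 1))) with (1 - z ^ 2) by ring.
    change (fun x => f x) with f. change (fun x => g x) with g.
    rewrite (is_derive_unique _ _ _ HA), (is_derive_unique _ _ _ HB).
    assert (H2 : 2 - z ^ 2 <> 0) by nra.
    unfold curve in EA, EB. rewrite <- Hc in EA, EB.
    set (c := sqrt (1 - z ^ 2)) in *. set (A := f z) in *. set (B := g z) in *.
    apply Rmult_eq_reg_r with (2 * (2 - z ^ 2)); [| lra].
    transitivity ((4 / c + 4 * z ^ 2 / c ^ 3) * (A - 2 * z ^ 2 * B) * (2 * (2 - z ^ 2))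
      + 4 / c * (z * dA * (2 * (2 - z ^ 2)) - 2 * z ^ 2 * (z * dB * (2 * (2 - z ^ 2)))
                 - 4 * z ^ 2 * B * (2 * (2 - z ^ 2)))).
    { field. lra. }
    rewrite EA, EB.
    assert (Hz2 : z ^ 2 = 1 - c ^ 2) by lra.
    field_simplify_eq; [| lra]. ring [Hz2].
Qed.

(** Imaginary part of the same identity 4 sin (2 w) (evenS u + t oddS u) = 2 w. *)
Lemma artanh_closed_form_neg (y : R) : in_disc y ->
  artanh y = 4 * y * (evenS (curve y) + 2 * y ^ 2 / (1 - y ^ 2) * oddS (curve y)).
Proof.
intros Hy.
apply (eq_of_derive artanh
  (fun y => 4 * y * (evenS (curve y) + 2 * y ^ 2 / (1 - y ^ 2) * oddS (curve y)))
  (fun y => / (1 - y ^ 2))).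
- apply Hy.
- rewrite artanh_0. ring.
- intros z Hz. apply is_derive_artanh.
  assert (0 <= z < 1) by now apply in_disc_lt_1, in_disc_le with y.
  lra.
- intros z Hz. apply (in_disc_le _ _ Hy) in Hz. clear y Hy.
  pose proof (in_disc_lt_1 z Hz) as Hz1. pose proof (one_minus_sq_pos z Hz1) as Hp.
  destruct (euler_evenS_oddS_curve z Hz) as (dA & dB & HA & HB & EA & EB).
  set (f := fun y => evenS (curve y)) in *. set (g := fun y => oddS (curve y)) in *.
  change (is_derive (fun y => 4 * y * (f y + 2 * y ^ 2 / (1 - y ^ 2) * g y))
            z (/ (1 - z ^ 2))).
  change (evenS (curve z)) with (f z) in *. change (oddS (curve z)) with (g z) in *.
  change (is_derive f z dA) in HA. change (is_derive g z dB) in HB.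
  clearbody f g.
  evar_last.
  + auto_derive; [| reflexivity].
    repeat split; [eexists; exact HA | nra | eexists; exact HB].
  + change (fun x => f x) with f. change (fun x => g x) with g.
    rewrite (is_derive_unique _ _ _ HA), (is_derive_unique _ _ _ HB).
    unfold curve in EA, EB.
    set (A := f z) in *. set (B := g z) in *.
    apply Rmult_eq_reg_r with (2 * (2 - z ^ 2)); [| lra].
    transitivity (4 * (A + 2 * z ^ 2 / (1 - z ^ 2) * B) * (2 * (2 - z ^ 2))
      + 4 * (z * dA * (2 * (2 - z ^ 2))
             + 2 * z ^ 2 / (1 - z ^ 2) * (z * dB * (2 * (2 - z ^ 2)))
             + 4 * z ^ 2 / (1 - z ^ 2) ^ 2 * B * (2 * (2 - z ^ 2)))).
    { field. lra. }
    rewrite EA, EB. field. lra.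
Qed.

(** The real part of w^2 for 2 w = asin y + i artanh y. *)
Lemma primS_closed_form_neg (y : R) : in_disc y ->
  curve y * primS (curve y) =
  (atan (y / sqrt (1 - y ^ 2)) ^ 2 - artanh y ^ 2) / 4.
Proof.
intros Hy.
apply (eq_of_derive (fun y => curve y * primS (curve y))
  (fun y => (atan (y / sqrt (1 - y ^ 2)) ^ 2 - artanh y ^ 2) / 4)
  (fun y => - (8 * y ^ 3 * (2 - y ^ 2) / (1 - y ^ 2) ^ 2) * (oddS (curve y) / 2))).
- apply Hy.
- unfold curve, Rdiv. rewrite pow_i, !Rmult_0_r, !Rmult_0_l, atan_0, artanh_0 by lia.
  ring.
- intros z Hz. apply (in_disc_le _ _ Hy) in Hz.
  apply (is_derive_comp (fun v => v * primS v) curve).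
  + now apply is_derive_mult_primS, Rabs_curve.
  + now apply is_derive_curve, in_disc_lt_1.
- intros z Hz. apply (in_disc_le _ _ Hy) in Hz.
  pose proof (in_disc_lt_1 z Hz) as Hz1.
  destruct (sqrt_one_minus_sq z Hz1) as [Hc0 Hc].
  evar_last.
  + apply (is_derive_ext (fun y => / 4 * (atan (y / sqrt (1 - y ^ 2)) ^ 2
             - artanh y ^ 2))); [intros t; simpl; field; lra |].
    apply @is_derive_scal, @is_derive_minus; apply is_derive_square.
    * now apply is_derive_atan_arcsine.
    * apply is_derive_artanh; lra.
  + cbv beta. change minus with Rminus; cbv beta.
    rewrite atan_closed_form_neg, artanh_closed_form_neg by assumption.
    set (c := sqrt (1 - z ^ 2)) in *. rewrite <- Hc.
    assert (Hz2 : z ^ 2 = 1 - c ^ 2) by lra.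
    field_simplify_eq; [| lra]. ring [Hz2].
Qed.

(** * Principal branches on the real and imaginary axes *)

Lemma is_series_RtoC (a : nat -> R) (l : R) :
  is_series a l ->
  @is_series C_AbsRing C_NormedModule (fun k => RtoC (a k)) (RtoC l).
Proof.
intros H.
apply (filterlim_ext (fun n => RtoC (sum_n a n))).
- intros n. induction n as [| n IH].
  + now rewrite !sum_O.
  + rewrite !sum_Sn, <- IH. unfold plus; simpl. apply RtoC_plus.
- apply filterlim_comp with (locally l); [exact H |].
  intros P [eps HP]. exists eps. intros y Hy.
  apply HP. split; [exact Hy | apply ball_center].
Qed.

Lemma Carg_pos (x : R) : 0 < x -> Carg (RtoC x) = 0.
Proof.
intros Hx. unfold Carg. rewrite Cmod_R, Rabs_pos_eq by lra.
unfold Re, Im, RtoC; simpl.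
destruct (Rle_dec 0 0) as [_ | H]; [| lra].
replace (x / x) with 1 by (field; lra). apply acos_1.
Qed.

Lemma Catanh_RtoC (y : R) : -1 < y < 1 -> Catanh (RtoC y) = RtoC (artanh y).
Proof.
intros Hy. unfold Catanh, artanh.
assert (Hq : 0 < (1 + y) / (1 - y)) by (apply Rdiv_lt_0_compat; lra).
replace ((1 + RtoC y) / (1 - RtoC y))%C with (RtoC ((1 + y) / (1 - y))).
- unfold Clog. rewrite Carg_pos, Cmod_R, Rabs_pos_eq by lra.
  now rewrite RtoC_mult, RtoC_inv by lra.
- rewrite RtoC_div, RtoC_plus, RtoC_minus by lra. reflexivity.
Qed.

Lemma Csqrt_neg (x : R) : x < 0 -> Csqrt (RtoC x) = (0, sqrt (- x)).
Proof.
intros Hx. unfold Csqrt, Carg. rewrite Cmod_R, Rabs_left by lra.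
unfold Re, Im, RtoC; simpl.
destruct (Rle_dec 0 0) as [_ | H]; [| lra].
replace (x / - x) with (- (1)) by (field; lra).
rewrite acos_opp, acos_1. replace ((PI - 0) / 2) with (PI / 2) by field.
rewrite cos_PI2, sin_PI2. unfold Cmult; simpl. f_equal; ring.
Qed.

(** (1 - i y) / (1 + i y) lies on the unit circle at angle - 2 atan y, which stays in
    (-PI, 0): no branch cut is met. *)
Lemma Catanh_imag (y : R) : 0 < y -> Catanh (0, - y)%R = (0, - atan y)%R.
Proof.
intros Hy. unfold Catanh.
assert (Hp : 0 < 1 + y ^ 2) by nra.
replace ((1 + (0, - y)%R) / (1 - (0, - y)%R))%C
  with ((1 - y ^ 2) / (1 + y ^ 2), - (2 * y / (1 + y ^ 2)))%R.
2:{ unfold Cdiv, Cmult, Cinv, Cplus, Cminus, Copp, RtoC; simpl.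
    f_equal; field; nra. }
assert (Hm : Cmod ((1 - y ^ 2) / (1 + y ^ 2), - (2 * y / (1 + y ^ 2)))%R = 1).
{ unfold Cmod; simpl. transitivity (sqrt 1); [f_equal; field; nra | apply sqrt_1]. }
unfold Clog, Carg. rewrite Hm, ln_1. unfold Re, Im; cbn [fst snd].
destruct (Rle_dec 0 (- (2 * y / (1 + y ^ 2)))) as [H | _].
{ assert (0 < 2 * y / (1 + y ^ 2)) by (apply Rdiv_lt_0_compat; lra). lra. }
replace ((1 - y ^ 2) / (1 + y ^ 2) / 1) with (cos (2 * atan y)).
- pose proof (atan_bound y). pose proof (atan_increasing 0 y Hy) as H0.
  rewrite atan_0 in H0.
  rewrite acos_cos by lra.
  replace (/ 2)%C with (RtoC (/ 2)) by (apply RtoC_inv; lra).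
  unfold Cmult, RtoC; simpl. f_equal; field.
- rewrite cos_2a_cos, cos_atan.
  assert (Hs : sqrt (1 + y²) * sqrt (1 + y²) = 1 + y ^ 2)
    by (rewrite sqrt_sqrt; unfold Rsqr; nra).
  assert (sqrt (1 + y²) <> 0) by nra.
  replace (2 * (1 / sqrt (1 + y²)) * (1 / sqrt (1 + y²)))
    with (2 / (sqrt (1 + y²) * sqrt (1 + y²))) by (field; assumption).
  rewrite Hs. field. lra.
Qed.

(** * The two summation formulas *)

Lemma acot_inv (r : R) : 0 < r -> acot r = atan (/ r).
Proof. intros Hr. symmetry. now apply atan_inv. Qed.

Lemma is_series_positive_arg (X : R) : 1 / 4 < X ->
  let r := sqrt (4 * X - 1) in let q := sqrt (4 * X + 1) in
  is_series
    (fun k => 1 / (INR (k + 1) * X ^ (2 * k) * Binomial.C (4 * k) (2 * k)))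
    (4 * X * (12 * X - 1) * acot r / r - 24 * X ^ 2 * acot r ^ 2
     - 4 * X * (12 * X + 1) * artanh (1 / q) / q
     + 24 * X ^ 2 * artanh (1 / q) ^ 2).
Proof.
intros HX r q.
assert (Hs := sqrt_lt_R0 X ltac:(lra)). assert (Hs2 := pow2_sqrt X ltac:(lra)).
assert (Hr := sqrt_lt_R0 (4 * X - 1) ltac:(lra)). fold r in Hr.
assert (Hq := sqrt_lt_R0 (4 * X + 1) ltac:(lra)). fold q in Hq.
set (s := sqrt X) in *. set (y := / (2 * s)).
assert (Hy2 : y ^ 2 = / (4 * X)) by (unfold y; rewrite <- Hs2; field; lra).
assert (Hy0 : 0 < y) by (apply Rinv_0_lt_compat; lra).
assert (Hy1 : 0 <= y < 1).
{ split; [lra |]. unfold y. rewrite <- Rinv_1. apply Rinv_lt_contravar; nra. }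
assert (Hu : 16 * y ^ 4 = / X ^ 2).
{ replace (y ^ 4) with (y ^ 2 * y ^ 2) by ring. rewrite Hy2. field. lra. }
assert (Hc : sqrt (1 - y ^ 2) = y * r).
{ unfold r. rewrite <- (sqrt_pow2 y) at 2 by lra.
  rewrite <- sqrt_mult by nra. f_equal. rewrite Hy2. field. lra. }
assert (Hd : sqrt (1 + y ^ 2) = y * q).
{ unfold q. rewrite <- (sqrt_pow2 y) at 2 by lra.
  rewrite <- sqrt_mult by nra. f_equal. rewrite Hy2. field. lra. }
pose proof (atan_closed_form y Hy1) as HW.
pose proof (artanh_closed_form y Hy1) as HV.
pose proof (primS_closed_form_pos y Hy1) as HI.
pose proof (is_series_inv_central_binomial _ (Rabs_16_pow4 y Hy1)) as HG.
rewrite Hc in HW, HI. rewrite Hd in HV, HI.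
replace (y / (y * r)) with (/ r) in HW, HI by (field; lra).
replace (y / (y * q)) with (1 / q) in HV, HI by (field; lra).
rewrite <- acot_inv in HW, HI by exact Hr.
rewrite Hu in *.
set (A := evenS (/ X ^ 2)) in *. set (B := oddS (/ X ^ 2)) in *.
set (M := primS (/ X ^ 2)) in *.
set (W := acot r) in *. set (V := artanh (1 / q)) in *.
assert (HW' : W / r = (A + B / X) / X).
{ rewrite HW. transitivity (4 * y ^ 2 * (A + 4 * y ^ 2 * B)); [field; lra |].
  rewrite Hy2. field. lra. }
assert (HV' : V / q = (A - B / X) / X).
{ rewrite HV. transitivity (4 * y ^ 2 * (A - 4 * y ^ 2 * B)); [field; lra |].
  rewrite Hy2. field. lra. }
match goal with |- is_series _ ?l =>
  replace l with (96 * B - 8 * A - 48 * M) end.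
- refine (is_series_ext _ _ _ _ HG).
  intros k. rewrite pow_inv, <- pow_mult.
  pose proof (pos_INR k).
  assert (HC := central_binomial_pos (2 * k)).
  replace (2 * (2 * k))%nat with (4 * k)%nat in HC by lia.
  rewrite plus_INR; change (INR 1) with 1.
  match goal with |- ?a = ?b => change (@eq R a b) end. field.
  assert (X ^ (2 * k) <> 0) by (apply pow_nonzero; lra).
  repeat split; lra || nra || assumption.
- replace M with (X ^ 2 * ((W ^ 2 - V ^ 2) / 2)) by (rewrite <- HI; field; lra).
  transitivity (4 * X * (12 * X - 1) * (W / r) - 24 * X ^ 2 * W ^ 2
    - 4 * X * (12 * X + 1) * (V / q) + 24 * X ^ 2 * V ^ 2); [| field; lra].
  rewrite HW', HV'. field. lra.
Qed.

Lemma is_series_negative_arg (x : R) : x > (1 + sqrt 2) / 2 ->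
  let s := sqrt x in let r := sqrt (x - 1) in
  is_series
    (fun k => 2 ^ (2 * k)
       / (INR (k + 1) * (x * (1 - x)) ^ k * Binomial.C (4 * k) (2 * k)))
    (2 * (1 - x) * (6 * x - 1) / (1 - 2 * x) * s * artanh (1 / s)
     + 2 * x * (6 * x - 5) / (1 - 2 * x) * r * atan (/ r)
     + 3 * x * (1 - x) * artanh (1 / s) ^ 2
     - 3 * x * (1 - x) * atan (/ r) ^ 2).
Proof.
intros Hx s r.
assert (H2 : 0 < sqrt 2) by (apply sqrt_lt_R0; lra).
assert (H22 : sqrt 2 * sqrt 2 = 2) by (apply sqrt_sqrt; lra).
assert (Hx1 : 1 < x) by nra.
assert (Hxx : 1 + 4 * x < 4 * x ^ 2) by nra.
assert (Hs := sqrt_lt_R0 x ltac:(lra)). assert (Hs2 := pow2_sqrt x ltac:(lra)).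
assert (Hr := sqrt_lt_R0 (x - 1) ltac:(lra)).
fold s in Hs, Hs2. fold r in Hr.
set (y := 1 / s).
assert (Hy0 : 0 < y) by (apply Rdiv_lt_0_compat; lra).
assert (Hy2 : y ^ 2 = / x) by (unfold y; rewrite <- Hs2; field; lra).
assert (Hy4 : y ^ 4 = / x ^ 2).
{ replace (y ^ 4) with (y ^ 2 * y ^ 2) by ring. rewrite Hy2. field. lra. }
assert (Hy : in_disc y).
{ split; [lra |]. rewrite Hy4, Hy2.
  replace (/ x ^ 2 + 4 * / x) with ((1 + 4 * x) / x ^ 2) by (field; lra).
  apply Rlt_div_l; nra. }
assert (Hu : curve y = 4 / (x * (1 - x))).
{ unfold curve. rewrite Hy4, Hy2. field. lra. }
assert (Hc : sqrt (1 - y ^ 2) = y * r).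
{ unfold r. rewrite <- (sqrt_pow2 y) at 2 by lra.
  rewrite <- sqrt_mult by nra. f_equal. rewrite Hy2. field. lra. }
pose proof (atan_closed_form_neg y Hy) as HW.
pose proof (artanh_closed_form_neg y Hy) as HV.
pose proof (primS_closed_form_neg y Hy) as HI.
pose proof (is_series_inv_central_binomial _ (Rabs_curve y Hy)) as HG.
rewrite Hc in HW, HI.
replace (y / (y * r)) with (/ r) in HW, HI by (field; lra).
rewrite Hu in *. rewrite Hy2 in HW, HV.
set (u := 4 / (x * (1 - x))) in *.
set (A := evenS u) in *. set (B := oddS u) in *. set (M := primS u) in *.
set (W := atan (/ r)) in *. set (V := artanh y) in *.
assert (HW' : r * W = 4 * (A - 2 * / x * B)) by (rewrite HW; field; lra).
assert (HV' : s * V = 4 * (A + 2 / (x - 1) * B)).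
{ rewrite HV. unfold y. field. lra. }
match goal with |- is_series _ ?l =>
  replace l with (96 * B - 8 * A - 48 * M) end.
- refine (is_series_ext _ _ _ _ HG).
  intros k. unfold u. rewrite pow_mult. unfold Rdiv at 2.
  rewrite Rpow_mult_distr, pow_inv.
  replace (2 ^ 2) with 4 by ring.
  pose proof (pos_INR k).
  assert (HC := central_binomial_pos (2 * k)).
  replace (2 * (2 * k))%nat with (4 * k)%nat in HC by lia.
  rewrite plus_INR; change (INR 1) with 1.
  match goal with |- ?a = ?b => change (@eq R a b) end. field.
  assert ((x * (1 - x)) ^ k <> 0) by (apply pow_nonzero; nra).
  repeat split; lra || nra || assumption.
- replace M with (x * (1 - x) / 4 * ((W ^ 2 - V ^ 2) / 4))
    by (rewrite <- HI; unfold u; field; lra).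
  transitivity (2 * (1 - x) * (6 * x - 1) / (1 - 2 * x) * (s * V)
     + 2 * x * (6 * x - 5) / (1 - 2 * x) * (r * W)
     + 3 * x * (1 - x) * V ^ 2 - 3 * x * (1 - x) * W ^ 2); [| field; lra].
  rewrite HW', HV'. field. lra.
Qed.

Open Scope C_scope.

(** Since 1 - x < 0, its square root is i sqrt (x - 1) and the inverse hyperbolic
    tangent of the reciprocal is - i atan (1 / sqrt (x - 1)): the two factors i
    cancel in the product, and the square changes sign. *)
Lemma is_series_negative_arg_complex (x : R) : (x > (1 + sqrt 2) / 2)%R ->
  @is_series C_AbsRing C_NormedModule
    (fun k : nat =>
       RtoC (2 ^ (2 * k)
             / (INR (k + 1) * (x * (1 - x)) ^ k * Binomial.C (4 * k) (2 * k))))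
    (RtoC (2 * (1 - x) * (6 * x - 1) / (1 - 2 * x))
       * Csqrt (RtoC x) * Catanh (1 / Csqrt (RtoC x))
     + RtoC (2 * x * (6 * x - 5) / (1 - 2 * x))
       * Csqrt (RtoC (1 - x)) * Catanh (1 / Csqrt (RtoC (1 - x)))
     + RtoC (3 * x * (1 - x)) * Catanh (1 / Csqrt (RtoC x)) ^ 2
     + RtoC (3 * x * (1 - x)) * Catanh (1 / Csqrt (RtoC (1 - x))) ^ 2).
Proof.
intros Hx.
assert (Hx1 : (1 < x)%R).
{ assert (1 <= sqrt 2)%R by (rewrite <- sqrt_1; apply sqrt_le_1_alt; lra). lra. }
assert (Hs : (1 < sqrt x)%R) by (rewrite <- sqrt_1; apply sqrt_lt_1_alt; lra).
assert (Hr := sqrt_lt_R0 (x - 1) ltac:(lra)).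
pose proof (is_series_RtoC _ _ (is_series_negative_arg x Hx)) as H.
rewrite Csqrt_pos, Csqrt_neg by lra.
replace (- (1 - x))%R with (x - 1)%R by ring.
replace (1 / RtoC (sqrt x)) with (RtoC (1 / sqrt x))
  by (rewrite RtoC_div by lra; reflexivity).
replace (1 / (0, sqrt (x - 1))%R) with ((0, - / sqrt (x - 1))%R : C).
2:{ unfold Cdiv, Cinv, Cmult, RtoC; simpl. f_equal; field; lra. }
rewrite Catanh_imag by now apply Rinv_0_lt_compat.
rewrite Catanh_RtoC.
2:{ split; [apply Rlt_div_r | apply Rlt_div_l]; lra. }
match type of H with is_series _ ?l => match goal with |- is_series _ ?m =>
  replace m with l; [exact H |] end end.
unfold Cmult, Cplus, RtoC, Cpow; simpl. f_equal; ring.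
Qed.

Theorem theorem1p3 :
  (forall X : R, (1 / 4 < X)%R ->
     @is_series C_AbsRing C_NormedModule
       (fun k : nat =>
          RtoC (1 / (INR (k + 1) * X ^ (2 * k) * Binomial.C (4 * k) (2 * k))))
       (RtoC (4 * X * (12 * X - 1)) * RtoC (acot (sqrt (4 * X - 1)))
          / RtoC (sqrt (4 * X - 1))
        - RtoC (24 * X ^ 2) * RtoC (acot (sqrt (4 * X - 1))) ^ 2
        - RtoC (4 * X * (12 * X + 1)) * Catanh (1 / RtoC (sqrt (4 * X + 1)))
          / RtoC (sqrt (4 * X + 1))
        + RtoC (24 * X ^ 2) * Catanh (1 / RtoC (sqrt (4 * X + 1))) ^ 2))
  /\
  (forall x : R,
     (x > (1 + sqrt 2) / 2)%R \/ (x < (1 - sqrt 2) / 2)%R ->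
     @is_series C_AbsRing C_NormedModule
       (fun k : nat =>
          RtoC (2 ^ (2 * k)
                / (INR (k + 1) * (x * (1 - x)) ^ k * Binomial.C (4 * k) (2 * k))))
       (RtoC (2 * (1 - x) * (6 * x - 1) / (1 - 2 * x))
          * Csqrt (RtoC x) * Catanh (1 / Csqrt (RtoC x))
        + RtoC (2 * x * (6 * x - 5) / (1 - 2 * x))
          * Csqrt (RtoC (1 - x)) * Catanh (1 / Csqrt (RtoC (1 - x)))
        + RtoC (3 * x * (1 - x)) * Catanh (1 / Csqrt (RtoC x)) ^ 2
        + RtoC (3 * x * (1 - x)) * Catanh (1 / Csqrt (RtoC (1 - x))) ^ 2))
  /\
  (forall x0 : R, (-16 < x0 < 0)%R ->
     exists x : R,
       ((x > (1 + sqrt 2) / 2)%R \/ (x < (1 - sqrt 2) / 2)%R)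
       /\ x0 = (4 / (x * (1 - x)))%R).
Proof.
split; [| split].
- intros X HX.
  assert (Hr := sqrt_lt_R0 (4 * X - 1) ltac:(lra)).
  assert (Hq : (1 < sqrt (4 * X + 1))%R) by (rewrite <- sqrt_1 at 1; apply sqrt_lt_1_alt; lra).
  pose proof (is_series_RtoC _ _ (is_series_positive_arg X HX)) as H.
  replace (1 / RtoC (sqrt (4 * X + 1))) with (RtoC (1 / sqrt (4 * X + 1)))
    by (rewrite RtoC_div by lra; reflexivity).
  rewrite Catanh_RtoC.
  2:{ split; [apply Rlt_div_r | apply Rlt_div_l]; lra. }
  match type of H with is_series _ ?l => match goal with |- is_series _ ?m =>
    replace m with l; [exact H |] end end.
  rewrite <- !RtoC_pow, <- !RtoC_mult, <- !RtoC_div by lra.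
  now rewrite <- !RtoC_minus, <- RtoC_plus.
- intros x [Hx | Hx]; [now apply is_series_negative_arg_complex |].
  assert (Hx' : (1 - x > (1 + sqrt 2) / 2)%R) by lra.
  pose proof (is_series_negative_arg_complex (1 - x) Hx') as H.
  replace (1 - (1 - x))%R with x in H by ring.
  assert (0 < sqrt 2)%R by (apply sqrt_lt_R0; lra).
  replace (2 * x * (6 * (1 - x) - 1) / (1 - 2 * (1 - x)))%R
    with (2 * x * (6 * x - 5) / (1 - 2 * x))%R in H by (field; lra).
  replace (2 * (1 - x) * (6 * (1 - x) - 5) / (1 - 2 * (1 - x)))%R
    with (2 * (1 - x) * (6 * x - 1) / (1 - 2 * x))%R in H by (field; lra).
  replace (3 * (1 - x) * x)%R with (3 * x * (1 - x))%R in H by ring.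
  replace ((1 - x) * x)%R with (x * (1 - x))%R in H by ring.
  match type of H with is_series _ ?l => match goal with |- is_series _ ?m =>
    replace m with l; [exact H |] end end.
  ring.
- intros x0 Hx0.
  assert (Ht : (1 < - (16 / x0))%R).
  { replace (- (16 / x0))%R with (16 / - x0)%R by (field; lra).
    apply Rlt_div_r; lra. }
  set (t := sqrt (1 - 16 / x0)).
  assert (Ht2 : (t * t = 1 - 16 / x0)%R) by (apply sqrt_sqrt; lra).
  assert (H2 : (sqrt 2 < t)%R) by (apply sqrt_lt_1_alt; lra).
  (* The larger root of x (1 - x) = 4 / x0. *)
  exists ((1 + t) / 2)%R. split; [left; lra |].
  replace ((1 + t) / 2 * (1 - (1 + t) / 2))%R with ((1 - t * t) / 4)%R by field.
  rewrite Ht2. field. lra.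
Qed.
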